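(* The directed flag complex homology functor $H\circ\mathrm{dFl}:\mathbf{TcDgr}\to\mathbf{grVec}$ factors through the quotient functor $[\bullet]_{\mathrm{dFl}}:\mathbf{TcDgr}\to\mathbf{h}_{\mathrm{dFl}}\mathbf{TcDgr}$. Therefore, for all functors $M,N:\mathbf R\to\mathbf{TcDgr}$, $$d_I\big((H\circ\mathrm{dFl})(M),(H\circ\mathrm{dFl})(N)\big)\le d_I\big([M]_{\mathrm{dFl}},[N]_{\mathrm{dFl}}\big)\le d_I(M,N).$$ More explicitly, for $\delta\ge0$, if there are natural transformations $f:M\Rightarrow N^{\delta}$ and $g:N\Rightarrow M^{\delta}$ such that $(g^{\delta}\circ f)(t)\simeq_{\mathrm{dFl}}T_M^{2\delta}(t)$ and $(f^{\delta}\circ g)(t)\simeq_{\mathrm{dFl}}T_N^{2\delta}(t)$ for every $t\in\mathbb R$, then $$d_I\big((H\circ\mathrm{dFl})(M),(H\circ\mathrm{dFl})(N)\big)\le\delta.$$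
   Context: All digraphs are simple (no self-loops). A directed $k$-clique is a $k$-tuple $v_0\dots v_{k-1}$ of distinct vertices with $v_i\to v_j$ whenever $i<j$. A map $f:V(G)\to V(H)$ is a triangle-collapsing digraph map if $v\to w$ in $G$ implies $f(v)=f(w)$ or $f(v)\to f(w)$, and whenever $v_0v_1v_2$ is a directed $3$-clique with $f(v_0)=f(v_2)$ then $f(v_0)=f(v_1)=f(v_2)$. $\mathbf{TcDgr}$ is the category of simple digraphs and triangle-collapsing digraph maps. Fix a field $\mathbb F$. $\mathrm{dFl}(G)$ is the complex of directed cliques of $G$; its chain complex has in degree $k$ the $\mathbb F$-vector space with basis the directed $(k+1)$-cliques $v_0\dots v_k$, and $\partial(v_0\dots v_k)=\sum_i(-1)^iv_0\dots\hat{v_i}\dots v_k$ (with $\partial_0=0$). A triangle-collapsing map $f$ induces the chain map sending $v_0\dots v_k$ to $f(v_0)\dots f(v_k)$ if these vertices are distinct, and to $0$ otherwise. $(H\circ\mathrm{dFl})(G)$ is the homology in all degrees, a graded vector space; this gives a functor $H\circ\mathrm{dFl}:\mathbf{TcDgr}\to\mathbf{grVec}$. For triangle-collapsing $f,g:G\to H$, say there is a one-step homotopy from $f$ to $g$ if (1) whenever $x=y$ or $x\to y$ in $G$ then $f(x)=g(y)$ or $f(x)\to g(y)$ in $H$; and (2) whenever $x\to y$ and $f(x)=g(y)$ then $f(x)=f(y)=g(x)=g(y)$. Let $\simeq_{\mathrm{dFl}}$ be the equivalence relation on triangle-collapsing maps $G\to H$ generated by this relation (finite zig-zags). It is compatible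 with composition. $\mathbf h_{\mathrm{dFl}}\mathbf{TcDgr}$ is the category with objects the simple digraphs and morphisms the $\simeq_{\mathrm{dFl}}$-classes of triangle-collapsing maps; $[\bullet]_{\mathrm{dFl}}$ denotes the images of objects, morphisms and (by composition) persistent objects. $\mathbf R$ is the poset $(\mathbb R,\le)$ as a category; a persistent $\mathcal C$-object is a functor $M:\mathbf R\to\mathcal C$. Functors out of $\mathcal C$ act on persistent objects by composition. The $\delta$-shift is $M^\delta(t)=M(t+\delta)$, $M^\delta(s\le t)=M(s+\delta\le t+\delta)$ (shift natural transformations similarly), and $T_M^{\delta}:M\Rightarrow M^\delta$ is $T^\delta_M(t)=M(t\le t+\delta)$. A $\delta$-interleaving in $\mathcal C$ between $M$ and $N$ is a pair of natural transformations $f:M\Rightarrow N^\delta$, $g:N\Rightarrow M^\delta$ with $g^\delta\circ f=T_M^{2\delta}$ and $f^\delta\circ g=T_N^{2\delta}$. The interleaving distance is $d_I(M,N)=\inf\{\delta\ge0: M,N\text{ are }\delta\text{-interleaved}\}\in[0,\infty]$ (with $\inf\emptyset=\infty$). *)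

(* Defs.v *)
From HB Require Import structures.
From mathcomp Require Import all_boot all_order all_algebra.
From mathcomp Require Import finmap monalg.
From mathcomp Require Import boolp classical_sets reals constructive_ereal ereal.
From Stdlib Require Import Relation_Operators.

Set Implicit Arguments.
Unset Strict Implicit.
Unset Printing Implicit Defensive.
Import Order.TTheory GRing.Theory Num.Theory Quotient.
Local Open Scope ring_scope.
Local Obligation Tactic := idtac.

Record category := Category {
  obj :> Type;
  hom : obj -> obj -> Type;
  idm : forall X, hom X X;
  compm : forall X Y Z, hom Y Z -> hom X Y -> hom X Z;
  comp1m : forall X Y (f : hom X Y), compm (idm Y) f = f;
  compm1 : forall X Y (f : hom X Y), compm f (idm X) = f;
  compmA : forall X Y Z W (h : hom Z W) (g : hom Y Z) (f : hom X Y),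
    compm h (compm g f) = compm (compm h g) f }.

Arguments hom {c} X Y.
Arguments idm {c} X.
Arguments compm {c X Y Z} g f.

Record functor (C D : category) := Functor {
  fobj :> C -> D;
  fmap : forall X Y : C, hom X Y -> hom (fobj X) (fobj Y);
  fmap1 : forall X : C, fmap (idm X) = idm (fobj X);
  fmapM : forall (X Y Z : C) (g : hom Y Z) (f : hom X Y),
    fmap (compm g f) = compm (fmap g) (fmap f) }.

Arguments fmap {C D} f [X Y] h : rename.

Program Definition fcomp (C D E : category) (G : functor D E) (F : functor C D) :
    functor C E :=
  @Functor C E (fun X => G (F X)) (fun X Y h => fmap G (fmap F h)) _ _.
Next Obligation. by move=> * /=; rewrite !fmap1. Qed.
Next Obligation. by move=> * /=; rewrite !fmapM. Qed.

Record nattrans (C D : category) (F G : functor C D) := NatTrans {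
  nt :> forall X : C, hom (F X) (G X);
  natural : forall (X Y : C) (h : hom X Y),
    compm (fmap G h) (nt X) = compm (nt Y) (fmap F h) }.

Program Definition ntcomp (C D : category) (F G H : functor C D)
    (b : nattrans G H) (a : nattrans F G) : nattrans F H :=
  @NatTrans C D F H (fun X => compm (b X) (a X)) _.
Next Obligation.
by move=> C D F G H b a X Y h /=; rewrite compmA natural -compmA natural compmA.
Qed.

Lemma nattrans_ext (C D : category) (F G : functor C D) (a b : nattrans F G) :
  (forall X, a X = b X) -> a = b.
Proof.
case: a b => [a Ha] [b Hb] /= e.
have {}e : a = b by apply: functional_extensionality_dep.
by case: _ / e Hb => Hb; congr NatTrans; apply: Prop_irrelevance.
Qed.

Program Definition realcat (R : realType) : category :=
  @Category R (fun s t => s <= t) (fun t => lexx t)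
    (fun r s t hst hrs => le_trans hrs hst) _ _ _.
Next Obligation. by move=> *; apply: Prop_irrelevance. Qed.
Next Obligation. by move=> *; apply: Prop_irrelevance. Qed.
Next Obligation. by move=> *; apply: Prop_irrelevance. Qed.

Lemma realhom_irr (R : realType) (s t : realcat R) (h k : hom s t) : h = k.
Proof. exact: (@Prop_irrelevance (s <= t) h k). Qed.

Definition persistent (R : realType) (C : category) := functor (realcat R) C.

Section Interleaving.
Variables (R : realType) (C : category).
Implicit Types (M N : persistent R C) (d : R).

Lemma shift_le d (s t : R) : s <= t -> s + d <= t + d.
Proof. by move=> h; rewrite lerD2r. Qed.

Program Definition shift d M : persistent R C :=
  @Functor (realcat R) C (fun t : R => M (t + d))
    (fun (s t : R) (h : s <= t) => @fmap _ _ M (s + d) (t + d) (shift_le d h)) _ _.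
Next Obligation.
by move=> d M t /=; rewrite -fmap1; congr fmap; apply: realhom_irr.
Qed.
Next Obligation.
by move=> d M r s t hst hrs /=; rewrite -fmapM; congr fmap; apply: realhom_irr.
Qed.

Program Definition shiftnt d M N (f : nattrans M N) :
    nattrans (shift d M) (shift d N) :=
  @NatTrans _ _ (shift d M) (shift d N) (fun t : R => f (t + d)) _.
Next Obligation. by move=> d M N f s t h /=; rewrite natural. Qed.

Lemma le_shift d (d0 : 0 <= d) (t : R) : t <= t + d.
Proof. by rewrite lerDl. Qed.

Program Definition transl d (d0 : 0 <= d) M : nattrans M (shift d M) :=
  @NatTrans _ _ M (shift d M) (fun t : R => @fmap _ _ M t (t + d) (le_shift d0 t)) _.
Next Obligation.
by move=> d d0 M s t h /=; rewrite -!fmapM; congr fmap; apply: realhom_irr.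
Qed.

Lemma shift2_le d (t : R) : t + 2 * d <= t + d + d.
Proof. by rewrite mulr_natl mulr2n addrA. Qed.

(* t + 2 * d and (t + d) + d are equal but not convertible; shift2 is the
   resulting identification of M^(2d) with (M^d)^d, given by the structure maps
   of M along this equality. *)
Program Definition shift2 d M : nattrans (shift (2 * d) M) (shift d (shift d M)) :=
  @NatTrans _ _ (shift (2 * d) M) (shift d (shift d M))
    (fun t : R => @fmap _ _ M (t + 2 * d) (t + d + d) (shift2_le d t)) _.
Next Obligation.
by move=> d M s t h /=; rewrite -!fmapM; congr fmap; apply: realhom_irr.
Qed.

Lemma double_ge0 d : 0 <= d -> 0 <= 2 * d.
Proof. by move=> d0; rewrite mulr_ge0. Qed.

Definition transl2 d (d0 : 0 <= d) M : nattrans M (shift d (shift d M)) :=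
  ntcomp (shift2 d M) (transl (double_ge0 d0) M).

Definition interleaved d (d0 : 0 <= d) M N : Prop :=
  exists (f : nattrans M (shift d N)) (g : nattrans N (shift d M)),
    ntcomp (shiftnt d g) f = transl2 d0 M /\
    ntcomp (shiftnt d f) g = transl2 d0 N.

Definition dI M N : \bar R :=
  ereal_inf [set d%:E | d in [set d : R | exists d0 : 0 <= d, interleaved d0 M N]].

End Interleaving.

Record digraph := Digraph {
  vertex :> choiceType;
  edge : rel vertex;
  edge_irr : irreflexive edge }.

Arguments edge {d} v w : rename.

Definition dclique (G : digraph) (s : seq G) : bool := uniq s && pairwise edge s.

Record tcmap (G H : digraph) := TcMap {
  tcfun :> G -> H;
  tc_edge : forall v w, edge v w -> tcfun v = tcfun w \/ edge (tcfun v) (tcfun w);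
  tc_triangle : forall v0 v1 v2, dclique [:: v0; v1; v2] -> tcfun v0 = tcfun v2 ->
    tcfun v0 = tcfun v1 /\ tcfun v1 = tcfun v2 }.

Lemma tcmap_ext (G H : digraph) (f g : tcmap G H) : f =1 g -> f = g.
Proof.
case: f g => [f f1 f2] [g g1 g2] /= /funext e.
by case: _ / e g1 g2 => g1 g2; congr TcMap; apply: Prop_irrelevance.
Qed.

Lemma dclique3 (G : digraph) (x y z : G) :
  dclique [:: x; y; z] = [&& edge x y, edge x z & edge y z].
Proof.
rewrite /dclique /= !inE !andbT negb_or.
have neq u v : @edge G u v -> u != v.
  by move=> e; apply/eqP => uv; move: e; rewrite uv edge_irr.
case xy: (edge x y); case xz: (edge x z); case yz: (edge y z);
  rewrite ?andbF //=.
by rewrite (neq _ _ xy) (neq _ _ xz) (neq _ _ yz).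
Qed.

Program Definition tcid (G : digraph) : tcmap G G := @TcMap G G id _ _.
Next Obligation. by move=> *; right. Qed.
Next Obligation.
by move=> G x y z; rewrite dclique3 => /and3P[_ xz _] e; move: xz; rewrite e edge_irr.
Qed.

Program Definition tccomp (G H K : digraph) (g : tcmap H K) (f : tcmap G H) :
  tcmap G K := @TcMap G K (g \o f) _ _.
Next Obligation.
move=> G H K g f v w vw /=; case: (tc_edge f vw) => [->|]; first by left.
exact: tc_edge.
Qed.
Next Obligation.
move=> G H K g f x y z xyz /= e.
case: (f x =P f z) => [exz|nxz]; first by case: (tc_triangle xyz exz) => -> ->.
have := xyz; rewrite dclique3 => /and3P[/(tc_edge f) xy /(tc_edge f) xz /(tc_edge f) yz].
case: xz => // xz; case: xy => [exy|xy]; first by rewrite -e exy.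
case: yz => [eyz|yz]; first by rewrite e eyz.
by apply: tc_triangle => //; rewrite dclique3 xy xz yz.
Qed.

Definition TcDgr : category.
refine (@Category digraph tcmap tcid tccomp _ _ _).
- by move=> *; apply: tcmap_ext.
- by move=> *; apply: tcmap_ext.
- by move=> *; apply: tcmap_ext.
Defined.

Definition one_step (G H : digraph) (f g : tcmap G H) : Prop :=
  (forall x y : G, x = y \/ edge x y -> f x = g y \/ edge (f x) (g y)) /\
  (forall x y : G, edge x y -> f x = g y ->
    [/\ f x = f y, f y = g x & g x = g y]).

Definition simeq (G H : digraph) : tcmap G H -> tcmap G H -> Prop :=
  clos_refl_sym_trans (tcmap G H) (@one_step G H).

Lemma one_step_compl (G H K : digraph) (h : tcmap H K) (f g : tcmap G H) :
  one_step f g -> one_step (tccomp h f) (tccomp h g).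
Proof.
case=> h1 h2; split=> x y xy /=.
  by case: (h1 _ _ xy) => [->|]; [left|exact: tc_edge].
move=> e; case: (f x =P g y) => [/(h2 _ _ xy)[]|nxy].
  by move=> -> -> ->; split.
case: (h1 x y (or_intror xy)) => // fxgy.
have fxx := h1 x x (or_introl erefl); have fyy := h1 y y (or_introl erefl).
have mid (z : H) : f x = z \/ edge (f x) z -> z = g y \/ edge z (g y) ->
    h (f x) = h z /\ h z = h (g y).
  move=> [<- //|xz] [->|zy]; first by rewrite e.
  by apply: tc_triangle => //; rewrite dclique3 xz zy fxgy.
have [e1 e2] := mid (f y) (tc_edge f xy) fyy.
have [e3 e4] := mid (g x) fxx (tc_edge g xy).
by split=> //; rewrite -?e1.
Qed.

Lemma one_step_compr (G H K : digraph) (f g : tcmap H K) (h : tcmap G H) :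
  one_step f g -> one_step (tccomp f h) (tccomp g h).
Proof.
case=> h1 h2; split=> x y xy /=.
  by apply: h1; case: xy => [->|/(tc_edge h)//]; left.
by case: (tc_edge h xy) => [-> -> //|]; apply: h2.
Qed.

Lemma simeq_comp (G H K : digraph) (g g' : tcmap H K) (f f' : tcmap G H) :
  simeq g g' -> simeq f f' -> simeq (tccomp g f) (tccomp g' f').
Proof.
move=> gg ff; apply: (@rst_trans _ _ _ (tccomp g f')).
  elim: ff => [a b /(one_step_compl g)|a|a b _|a b c _ + _]; first exact: rst_step.
  - exact: rst_refl.
  - exact: rst_sym.
  - exact: rst_trans.
elim: gg => [a b /(one_step_compr f')|a|a b _|a b c _ + _]; first exact: rst_step.
- exact: rst_refl.
- exact: rst_sym.
- exact: rst_trans.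
Qed.

HB.instance Definition _ (G H : digraph) := gen_eqMixin (tcmap G H).
HB.instance Definition _ (G H : digraph) := gen_choiceMixin (tcmap G H).

Section HomotopyClasses.
Variables G H : digraph.
Local Open Scope quotient_scope.

Definition simeqb (f g : tcmap G H) : bool := `[< simeq f g >].

Lemma simeqb_equiv : equiv_class_of simeqb.
Proof.
split=> [f|f g|g f h].
- by apply/asboolP; apply: rst_refl.
- by apply/asboolP/asboolP; apply: rst_sym.
- by move=> /asboolP fg /asboolP gh; apply/asboolP; apply: rst_trans gh.
Qed.

Canonical simeqb_equivRel := EquivRelPack simeqb_equiv.
Canonical simeqb_encModRel := defaultEncModRel simeqb.

Definition htcmap := {eq_quot simeqb}.
HB.instance Definition _ : EqQuotient _ simeqb htcmap := EqQuotient.on htcmap.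

Definition hclass (f : tcmap G H) : htcmap := \pi_htcmap f.

Lemma hclassP (f g : tcmap G H) : hclass f = hclass g <-> simeq f g.
Proof.
rewrite /hclass; split=> [/eqP|fg]; first by rewrite eqmodE => /asboolP.
by apply/eqP; rewrite eqmodE; apply/asboolP.
Qed.

Lemma hclass_repr (c : htcmap) : hclass (repr c) = c.
Proof. exact: reprK. Qed.

End HomotopyClasses.

Definition hcomp (G H K : digraph) (g : htcmap H K) (f : htcmap G H) : htcmap G K :=
  hclass (tccomp (repr g) (repr f)).

Lemma hcompE (G H K : digraph) (g : tcmap H K) (f : tcmap G H) :
  hcomp (hclass g) (hclass f) = hclass (tccomp g f).
Proof. by apply/hclassP/simeq_comp; apply/hclassP; rewrite hclass_repr. Qed.

Definition hTcDgr : category.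
refine (@Category digraph htcmap (fun G => hclass (tcid G)) hcomp _ _ _).
- move=> G H f; rewrite -(hclass_repr f) hcompE; congr hclass; exact: tcmap_ext.
- move=> G H f; rewrite -(hclass_repr f) hcompE; congr hclass; exact: tcmap_ext.
- move=> G H K L h g f; rewrite -(hclass_repr h) -(hclass_repr g) -(hclass_repr f).
  by rewrite !hcompE; congr hclass; apply: tcmap_ext.
Defined.

Definition hquot : functor TcDgr hTcDgr.
refine (@Functor TcDgr hTcDgr (fun G => G) (fun G H f => hclass f) _ _).
- by [].
- by move=> G H K g f; rewrite /= hcompE.
Defined.

Lemma linear_ext (F : fieldType) (U V : lmodType F) (f g : {linear U -> V}) :
  f =1 g -> f = g.
Proof.
case: f g => [f cf] [g cg] /= /funext e.
case: _ / e cg => cg; congr GRing.Linear.Pack.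
case: cf cg => [[a] [b]] [[a'] [b']].
by congr GRing.Linear.Class; congr (_ _); apply: Prop_irrelevance.
Qed.

Definition grVec (F : fieldType) : category.
refine (@Category (nat -> lmodType F) (fun U V => forall k, {linear U k -> V k})
  (fun U k => idfun) (fun U V W g f k => g k \o f k) _ _ _).
- by move=> *; apply: functional_extensionality_dep => k; apply: linear_ext.
- by move=> *; apply: functional_extensionality_dep => k; apply: linear_ext.
- by move=> *; apply: functional_extensionality_dep => k; apply: linear_ext.
Defined.

(* Non-negatively graded chain complexes.  The differential in degree 0 is
   typed C 0 -> C 0.-1 = C 0 and required to be zero, so that every element of
   C 0 is a cycle, while diff k.+1 : C k.+1 -> C k. *)
Record chcx (F : fieldType) := ChCx {
  chain :> nat -> lmodType F;
  diff : forall k, {linear chain k -> chain k.-1};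
  diff0 : forall x, diff 0 x = 0;
  diffK : forall k x, diff k (diff k.+1 x) = 0 }.

Record chmap (F : fieldType) (C D : chcx F) := ChMap {
  chmapf :> forall k, {linear C k -> D k};
  chmapP : forall k x, chmapf k.-1 (diff C k x) = diff D k (chmapf k x) }.

Lemma chmap_ext (F : fieldType) (C D : chcx F) (f g : chmap C D) :
  (forall k, f k =1 g k) -> f = g.
Proof.
case: f g => [f Hf] [g Hg] /= e.
have {}e : f = g.
  by apply: functional_extensionality_dep => k; apply: linear_ext; apply: e.
by case: _ / e Hg => Hg; congr ChMap; apply: Prop_irrelevance.
Qed.

Program Definition chid (F : fieldType) (C : chcx F) : chmap C C :=
  @ChMap F C C (fun k => idfun) _.
Next Obligation. by []. Qed.

Program Definition chcomp (F : fieldType) (C D E : chcx F)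
    (g : chmap D E) (f : chmap C D) : chmap C E :=
  @ChMap F C E (fun k => g k \o f k) _.
Next Obligation. by move=> F C D E g f k x /=; rewrite !chmapP. Qed.

Definition Ch (F : fieldType) : category.
refine (@Category (chcx F) (@chmap F) (@chid F) (@chcomp F) _ _ _).
- by move=> *; apply: chmap_ext.
- by move=> *; apply: chmap_ext.
- by move=> *; apply: chmap_ext.
Defined.

Section Homology.
Variable F : fieldType.

Section Object.
Variables (C : chcx F) (k : nat).

Definition cyclep : {pred C k} := fun x => diff C k x == 0.

Lemma cyclep_submod : submod_closed cyclep.
Proof.
split; rewrite ?unfold_in ?linear0 // => a x y.
by rewrite !unfold_in => /eqP hx /eqP hy; rewrite linearP hx hy scaler0 addr0.
Qed.
HB.instance Definition _ := GRing.isSubmodClosed.Build F (C k) cyclep cyclep_submod.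

Record cycle := Cycle { cycle_val : C k; _ : cycle_val \in cyclep }.
HB.instance Definition _ := [isSub for cycle_val].
HB.instance Definition _ := [Choice of cycle by <:].
HB.instance Definition _ := [SubChoice_isSubLmodule of cycle by <:].

Definition boundaryp : {pred cycle} :=
  fun x => `[< exists y : C k.+1, diff C k.+1 y = val x >].

Lemma boundaryp_submod : submod_closed boundaryp.
Proof.
split; rewrite ?unfold_in.
  by apply/asboolP; exists 0; rewrite !linear0.
move=> a x y; rewrite !unfold_in => /asboolP[u ux] /asboolP[v vy].
by apply/asboolP; exists (a *: u + v); rewrite !linearP ux vy.
Qed.
HB.instance Definition _ :=
  GRing.isSubmodClosed.Build F cycle boundaryp boundaryp_submod.

Definition hquotient := {quot boundaryp}.
HB.instance Definition _ := GRing.Zmodule.on hquotient.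

Definition hmlclass (x : cycle) : hquotient := \pi_({quot boundaryp})%qT x.
Definition hmlrepr (x : hquotient) : cycle := @repr _ {quot boundaryp} x.

Lemma hmlreprK x : hmlclass (hmlrepr x) = x.
Proof. exact: reprK. Qed.

Lemma hmlclassP x y : hmlclass x = hmlclass y <-> x - y \in boundaryp.
Proof. by rewrite idealrBE; split=> [h|/eqP]; first apply/eqP. Qed.

Lemma hmlclassD : {morph hmlclass : x y / x + y}.
Proof. by move=> x y; rewrite /hmlclass raddfD. Qed.

Definition hscale (a : F) (x : hquotient) : hquotient := hmlclass (a *: hmlrepr x).

Lemma hscaleE a (x : cycle) : hscale a (hmlclass x) = hmlclass (a *: x).
Proof.
by apply/hmlclassP; rewrite -scalerBr rpredZ //; apply/hmlclassP; rewrite hmlreprK.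
Qed.

Lemma hscaleA a b x : hscale a (hscale b x) = hscale (a * b) x.
Proof. by rewrite -[x]hmlreprK !hscaleE scalerA. Qed.

Lemma hscale1 : left_id 1 hscale.
Proof. by move=> x; rewrite -[x]hmlreprK hscaleE scale1r. Qed.

Lemma hscaleDr : right_distributive hscale +%R.
Proof.
move=> a x y; rewrite -[x]hmlreprK -[y]hmlreprK -hmlclassD !hscaleE -hmlclassD.
by rewrite scalerDr.
Qed.

Lemma hscaleDl x : {morph hscale^~ x : a b / a + b}.
Proof. by move=> a b; rewrite -[x]hmlreprK !hscaleE scalerDl hmlclassD. Qed.

HB.instance Definition _ := GRing.Zmodule_isLmodule.Build F hquotient
  hscaleA hscale1 hscaleDr hscaleDl.

Definition homology : lmodType F := hquotient.

Lemma hmlclass_linear : linear (hmlclass : cycle -> homology).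
Proof. by move=> a x y; rewrite hmlclassD -hscaleE. Qed.

End Object.

Section Morphism.
Variables (C D : chcx F) (f : chmap C D) (k : nat).

Lemma cycle_map_subproof (x : cycle C k) : f k (val x) \in @cyclep D k.
Proof.
by rewrite unfold_in -chmapP; case: x => x /= /eqP ->; rewrite linear0.
Qed.

Definition cycle_map (x : cycle C k) : cycle D k := Cycle (cycle_map_subproof x).

Definition hml_map (x : homology C k) : homology D k :=
  hmlclass (cycle_map (hmlrepr x)).

Lemma hml_mapE (x : cycle C k) : hml_map (hmlclass x) = hmlclass (cycle_map x).
Proof.
apply/hmlclassP.
have /asboolP[y hy] : hmlrepr (hmlclass x) - x \in @boundaryp C k.
  by apply/hmlclassP; rewrite hmlreprK.
by apply/asboolP; exists (f k.+1 y); rewrite -(@chmapP _ _ _ f k.+1) /= hy !raddfB.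
Qed.

Lemma hml_map_linear : linear hml_map.
Proof.
move=> a x y; rewrite -[x]hmlreprK -[y]hmlreprK -hmlclass_linear !hml_mapE.
by rewrite -hmlclass_linear; congr hmlclass; apply/val_inj; rewrite /= !linearP.
Qed.
HB.instance Definition _ :=
  GRing.isLinear.Build F (homology C k) (homology D k) _ hml_map hml_map_linear.

End Morphism.
End Homology.

Definition Hml (F : fieldType) : functor (Ch F) (grVec F).
refine (@Functor (Ch F) (grVec F) (fun C k => homology C k)
  (fun C D f k => @hml_map F C D f k) _ _).
- move=> C; apply: functional_extensionality_dep => k; apply: linear_ext => x /=.
  by rewrite -[x]hmlreprK hml_mapE; congr hmlclass; apply: val_inj.
- move=> C D E g f; apply: functional_extensionality_dep => k.
  apply: linear_ext => x /=.
  by rewrite -[x]hmlreprK !hml_mapE; congr hmlclass; apply: val_inj.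
Defined.

Section LinearExtension.
Variables (F : fieldType) (K : choiceType) (V : lmodType F) (h : K -> V).

Definition linext (x : {malg F[K]}) : V := \sum_(c <- msupp x) x@_c *: h c.

Lemma linextEw (A : {fset K}) (x : {malg F[K]}) :
  fsubset (msupp x) A -> linext x = \sum_(c <- A) x@_c *: h c.
Proof.
move=> sA; rewrite /linext (big_fset_incl _ sA) // => c _ /mcoeff_outdom ->.
by rewrite scale0r.
Qed.

Lemma linext_linear : linear linext.
Proof.
move=> a x y; set A := fsetU (msupp x) (msupp y).
have sx : fsubset (msupp x) A by apply: fsubsetUl.
have sy : fsubset (msupp y) A by apply: fsubsetUr.
have sxy : fsubset (msupp (a *: x + y)) A.
  by apply: (fsubset_trans (msuppD_le _ _)); apply/fsetSU/msuppZ_le.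
rewrite (linextEw sx) (linextEw sy) (linextEw sxy) scaler_sumr -big_split /=.
by apply: eq_bigr => c _; rewrite mcoeffD mcoeffZ scalerDl scalerA.
Qed.
HB.instance Definition _ := GRing.isLinear.Build F {malg F[K]} V _ linext linext_linear.

Lemma linextU c : linext << c >> = h c.
Proof.
by rewrite /linext msuppU oner_eq0 big_seq_fset1 mcoeffUU scale1r.
Qed.

End LinearExtension.

Lemma malg_linear_eq (F : fieldType) (K : choiceType) (V : lmodType F)
    (f g : {linear {malg F[K]} -> V}) :
  (forall c, f << c >> = g << c >>) -> f =1 g.
Proof.
move=> e x; rewrite (monalgE x) !linear_sum; apply: eq_bigr => c _ /=.
have -> : << x@_c *g c >> = x@_c *: << c >> :> {malg F[K]}.
  by apply/malgP => d; rewrite mcoeffZ !mcoeffU mulrnAr mulr1.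
by rewrite !linearZ e.
Qed.

Definition clique (G : digraph) (k : nat) : choiceType :=
  {s : seq G | (size s == k.+1) && dclique s}.

Definition face (T : Type) (i : nat) (s : seq T) : seq T := take i s ++ drop i.+1 s.

Lemma size_face (T : Type) (i : nat) (s : seq T) :
  (i < size s)%N -> size (face i s) = (size s).-1.
Proof.
move=> hi; rewrite size_cat size_take size_drop hi.
by case: (size s) hi => // n; rewrite ltnS subSS => /subnKC.
Qed.

Lemma face_subseq (T : eqType) (i : nat) (s : seq T) : subseq (face i s) s.
Proof.
rewrite -{2}(cat_take_drop i s) cat_subseq //.
by rewrite -[i.+1]add1n -drop_drop drop_subseq.
Qed.

Lemma map_face (T U : Type) (f : T -> U) (i : nat) (s : seq T) :
  map f (face i s) = face i (map f s).
Proof. by rewrite map_cat map_take map_drop. Qed.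

Lemma face_face (T : Type) (i j : nat) (s : seq T) :
  (j < i)%N -> (i < size s)%N -> face j (face i s) = face i.-1 (face j s).
Proof.
rewrite /face; elim: s i j => [|x s IH] [|i] [|j] //= ji si.
  by rewrite !drop0.
by case: i ji si => // i ji si; rewrite IH.
Qed.

Lemma face_dclique (G : digraph) (i : nat) (s : seq G) :
  dclique s -> dclique (face i s).
Proof.
case/andP=> us es; rewrite /dclique (subseq_uniq (face_subseq i s) us).
exact: (subseq_pairwise (face_subseq i s)).
Qed.

Lemma map_dclique (G H : digraph) (f : tcmap G H) (s : seq G) :
  dclique s -> dclique (map f s) = uniq (map f s).
Proof.
case/andP=> _ es; rewrite /dclique; case: (boolP (uniq _)) => //= us.
rewrite pairwise_map; elim: s es us => //= x s IH /andP[xs es] /andP[nx us].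
rewrite IH // andbT; apply/allP => y ys /=.
case: (tc_edge f (allP xs _ ys)) => // e.
by move: nx; rewrite e map_f.
Qed.

Lemma map_dclique_collapse (G H : digraph) (f : tcmap G H) (s : seq G) :
  dclique s -> ~~ uniq (map f s) ->
  exists s1 x y s2, s = s1 ++ [:: x, y & s2] /\ f x = f y.
Proof.
rewrite /dclique; elim: s => //= x s IH /andP[/andP[xs us] /andP[exs es]].
rewrite negb_and negbK; case/orP => [/mapP[z zs fz]|nu]; last first.
  case: IH => [|//|s1 [a [b [s2 [-> e]]]]]; first by rewrite us.
  by exists (x :: s1), a, b, s2.
case: s xs us exs es zs {IH} => // y s xs us exs es.
rewrite inE => /predU1P[zy|zs].
  by exists [::], x, y, s; rewrite -zy.
exists [::], x, y, s; split=> //.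
have [] // := @tc_triangle _ _ f x y z.
move: exs es => /= /andP[exy /allP exs] /andP[/allP eys _].
by rewrite dclique3 exy exs // eys.
Qed.

Lemma alternating_cancel (R : pzRingType) (W : lmodType R)
    (a : nat -> nat -> W) (n : nat) :
  (forall i j, (j < i)%N -> (i < n.+2)%N -> a i j = a j i.-1) ->
  \sum_(i < n.+2) \sum_(j < n.+1) (-1) ^+ (i + j) *: a i j = 0.
Proof.
elim: n a => [|n IH] a ha.
  rewrite !big_ord_recl !big_ord0 /= !addr0 expr0 scale1r expr1 scaleN1r.
  by rewrite (ha 1%N 0%N) // subrr.
have step (i : 'I_n.+2) : \sum_(j < n.+2) (-1) ^+ (lift ord0 i + j) *: a (lift ord0 i) j =
    (-1) ^+ i.+1 *: a i.+1 0%N + \sum_(j < n.+1) (-1) ^+ (i + j) *: a i.+1 j.+1.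
  rewrite big_ord_recl /= /bump /= ?add1n addn0; congr (_ + _).
  apply: eq_bigr => j _; rewrite /= ?add1n ?addnS ?addSn !exprS mulN1r.
  by rewrite mulN1r opprK.
rewrite big_ord_recl (eq_bigr _ (fun i _ => step i)) {step}.
rewrite big_split /= (IH (fun i j => a i.+1 j.+1)) ?addr0; last first.
  by move=> i j ji hi; rewrite ha //=; case: i ji hi.
rewrite -big_split big1 //= => i _.
have hi : (i.+1 < n.+3)%N by rewrite ltnS.
by rewrite add0n (ha _ 0%N _ hi) // exprS mulN1r scaleNr subrr.
Qed.

Lemma face_cons (T : Type) (i : nat) (x : T) (s : seq T) :
  face i.+1 (x :: s) = x :: face i s.
Proof. by []. Qed.

Lemma face_dup (T : Type) (s t : seq T) (y : T) :
  face (size s).+1 (s ++ [:: y, y & t]) = face (size s) (s ++ [:: y, y & t]).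
Proof. by elim: s => [|x s IH]; rewrite ?face_cons ?IH //= /face /= !drop0. Qed.

Lemma face_dup_nuniq (T : eqType) (s t : seq T) (y : T) (i : nat) :
  i != size s -> i != (size s).+1 -> uniq (face i (s ++ [:: y, y & t])) = false.
Proof.
elim: s i => [|x s IH] [|i] //; rewrite ?cat_cons ?eqSS.
- by case: i => // i _ _; rewrite /face /= inE eqxx.
- by move=> _ _; rewrite /face /= ?drop0 cat_uniq /= inE eqxx /= !andbF.
- by move=> i1 i2; rewrite face_cons /= IH ?andbF.
Qed.

Lemma big_two_cancel (V : zmodType) (n i0 : nat) (g : nat -> V) :
  (i0.+1 < n)%N -> g i0 + g i0.+1 = 0 ->
  (forall i, i != i0 -> i != i0.+1 -> g i = 0) -> \sum_(i < n) g i = 0.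
Proof.
move=> hi g0 gi; rewrite (bigD1 (Ordinal (ltnW hi))) //=.
rewrite (bigD1 (Ordinal hi)) /=; last by rewrite -val_eqE /= gtn_eqF.
rewrite addrA g0 add0r big1 // => i; rewrite -!val_eqE /= => /andP[i1 i2].
exact: gi.
Qed.

Section FlagComplex.
Variable F : fieldType.

Definition flagchain (G : digraph) (k : nat) : lmodType F := {malg F[clique G k]}.

(* The basis vector of the directed (k+1)-clique s.  The value 0 on a sequence
   that is not a directed (k+1)-clique is a dummy: by face_dclique and
   map_dclique it does not occur in flagdiff and flagmap. *)
Definition basisv (G : digraph) (k : nat) (s : seq G) : flagchain G k :=
  if insub s is Some c then << c >> else 0.

Definition flagdiff (G : digraph) (k : nat) : flagchain G k -> flagchain G k.-1 :=
  linext (fun c : clique G k =>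
    if k == 0%N then 0
    else \sum_(i < k.+1) (-1) ^+ i *: basisv k.-1 (face i (val c))).

Definition flagmap (G H : digraph) (f : tcmap G H) (k : nat) :
    flagchain G k -> flagchain H k :=
  linext (fun c : clique G k =>
    if uniq (map f (val c)) then basisv k (map f (val c)) else 0).

HB.instance Definition _ G k := GRing.Linear.copy (@flagdiff G k) (linext _).
HB.instance Definition _ G H f k := GRing.Linear.copy (@flagmap G H f k) (linext _).

Lemma basisvE (G : digraph) (k : nat) (c : clique G k) : basisv k (val c) = << c >>.
Proof. by rewrite /basisv valK. Qed.

Lemma flagdiffE (G : digraph) (k : nat) (s : seq G) :
  size s = k.+2 -> dclique s ->
  flagdiff (basisv k.+1 s) = \sum_(i < k.+2) (-1) ^+ i *: basisv k (face i s).
Proof.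
move=> sz cs; rewrite /basisv insubT ?sz ?eqxx // => h.
by rewrite /flagdiff linextU.
Qed.

Lemma flagmapE (G H : digraph) (f : tcmap G H) (k : nat) (s : seq G) :
  size s = k.+1 -> dclique s ->
  flagmap f (basisv k s) = if uniq (map f s) then basisv k (map f s) else 0.
Proof.
move=> sz cs; rewrite /basisv insubT ?sz ?eqxx // => h.
by rewrite /flagmap linextU.
Qed.

Lemma cliqueP (G : digraph) (k : nat) (c : clique G k) :
  size (val c) = k.+1 /\ dclique (val c).
Proof. by case: c => s /= /andP[/eqP]. Qed.

Lemma flagdiff0 (G : digraph) (x : flagchain G 0) : flagdiff x = 0.
Proof.
by rewrite /flagdiff /linext big1 // => c _; rewrite scaler0.
Qed.

Lemma flagdiffK (G : digraph) (k : nat) (x : flagchain G k.+1) :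
  flagdiff (flagdiff x) = 0.
Proof.
case: k x => [|k] x; first exact: flagdiff0.
apply: (@malg_linear_eq _ _ _ (@flagdiff G k.+1 \o @flagdiff G k.+2) \0) => c /=.
have [sz cs] := cliqueP c.
rewrite -basisvE flagdiffE // linear_sum /=.
rewrite -[RHS](@alternating_cancel F _ (fun i j => basisv k (face j (face i (val c)))) k.+1).
  apply: eq_bigr => i _; rewrite linearZ /= flagdiffE ?face_dclique //.
    by rewrite scaler_sumr; apply: eq_bigr => j _; rewrite scalerA exprD.
  by rewrite size_face sz.
by move=> i j ji hi; rewrite face_face // sz.
Qed.

Definition flagcx (G : digraph) : chcx F :=
  @ChCx F (flagchain G) (fun k => @flagdiff G k) (@flagdiff0 G) (@flagdiffK G).

Lemma flagmap_diff (G H : digraph) (f : tcmap G H) k (x : flagchain G k) :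
  flagmap f (flagdiff x) = flagdiff (flagmap f x).
Proof.
case: k x => [|k] x; first by rewrite !flagdiff0 linear0.
apply: (@malg_linear_eq _ _ _ (@flagmap _ _ f k \o @flagdiff G k.+1)
  (@flagdiff H k.+1 \o @flagmap _ _ f k.+1)) => c /=.
have [sz cs] := cliqueP c.
rewrite -basisvE flagdiffE // linear_sum /= flagmapE //.
under eq_bigr => i _ do
  rewrite linearZ /= flagmapE ?face_dclique ?size_face ?sz // map_face.
case: (boolP (uniq _)) => [us|nu].
  have szf : size (map f (val c)) = k.+2 by rewrite size_map.
  have cf : dclique (map f (val c)) by rewrite map_dclique.
  rewrite (flagdiffE szf cf); apply: eq_bigr => i _.
  by rewrite (subseq_uniq (face_subseq i _) us).
rewrite linear0; have [s1 [a [b [s2 [e fab]]]]] := map_dclique_collapse cs nu.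
have e' : sval c = s1 ++ [:: a, b & s2] := e.
move: sz; rewrite e e' !map_cat /= fab size_cat /= !addnS => -[sz].
rewrite -(size_map f) in sz.
have hi : ((size (map f s1)).+1 < k.+2)%N by rewrite !ltnS -sz leq_addr.
set t := map f s1 ++ _; pose w i := if uniq (face i t) then basisv k (face i t) else 0.
apply: (big_two_cancel (g := fun i => (-1) ^+ i *: w i) hi) => [|i i1 i2]; rewrite /w.
  by rewrite face_dup exprS mulN1r scaleNr subrr.
by rewrite face_dup_nuniq ?scaler0.
Qed.

Definition flagchmap (G H : digraph) (f : tcmap G H) :
    chmap (flagcx G) (flagcx H) :=
  @ChMap F (flagcx G) (flagcx H) (fun k => @flagmap G H f k) (@flagmap_diff G H f).

Definition dFl : functor TcDgr (Ch F).
refine (@Functor TcDgr (Ch F) flagcx (@flagchmap) _ _).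
- move=> G; apply: chmap_ext => k.
  apply: (@malg_linear_eq _ _ _ (@flagmap _ _ (tcid G) k) idfun) => c /=.
  have [sz cs] := cliqueP c.
  by rewrite -basisvE flagmapE // map_id; case/andP: cs => ->.
- move=> G H K g f; apply: chmap_ext => k.
  apply: (@malg_linear_eq _ _ _ (@flagmap _ _ (tccomp g f) k)
    (@flagmap _ _ g k \o @flagmap _ _ f k)) => c /=.
  have [sz cs] := cliqueP c.
  rewrite -basisvE !flagmapE // map_comp; case: (boolP (uniq (map f _))) => us.
    by rewrite flagmapE ?size_map ?map_dclique.
  by rewrite linear0 ifF //; apply/negbTE; apply: contra us => /map_uniq.
Defined.

End FlagComplex.

Definition HdFl (F : fieldType) : functor TcDgr (grVec F) := fcomp (Hml F) (dFl F).

(* Main.v *)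
From HB Require Import structures.
From mathcomp Require Import all_boot all_order all_algebra.
From mathcomp Require Import monalg.
From mathcomp Require Import boolp classical_sets reals constructive_ereal ereal.
Require Import Defs.
Set Implicit Arguments.
Unset Strict Implicit.
Unset Printing Implicit Defensive.
Import Order.TTheory GRing.Theory Num.Theory.
Local Open Scope ring_scope.

(** Homotopic triangle-collapsing maps induce the same map on homology, and the
    rest is formal.

    For a one-step homotopy from f to g the chain homotopy is the classical
    prism operator, which sends a clique v_0 ... v_k to the alternating sum of
    the sequences f(v_0) ... f(v_i) g(v_i) ... g(v_k).  The identity between
    the prism operator and the faces holds for an arbitrary function of
    sequences ([prism_identity]).  What depends on the definition of a homotopy
    is that a degenerate prism may be set to 0 compatibly with the boundary.
    The boundary of a degenerate sequence cancels as soon as two equal entries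
    are adjacent; condition (2) of a homotopy and the triangle-collapsing
    property guarantee exactly that: a prism over a clique either is a clique
    or has two equal adjacent entries ([prism_clique]).  So
    the chain maps of f and g differ by a chain homotopy ([flag_prism]),
    homology identifies them, and the functor H o dFl is constant on the
    classes of the generated equivalence relation; hence it descends to the
    homotopy category.

    Any functor sends interleavings to interleavings and so does not increase
    the interleaving distance ([dI_fcomp]).  This gives both inequalities, one
    for the quotient functor and one for the descended homology functor.  In
    the explicit form, the hypothesis says that the classes of f and g
    interleave the classes of the two persistent digraphs. *)

(** * Functors and the interleaving distance *)

Lemma functor_ext (C D : category) (o : C -> D)
    (m m' : forall X Y : C, hom X Y -> hom (o X) (o Y)) m1 mM m1' mM' :
  (forall X Y (h : hom X Y), m X Y h = m' X Y h) ->
  @Functor C D o m m1 mM = @Functor C D o m' m1' mM'.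
Proof.
move=> e; have {}e : m = m'.
  apply: functional_extensionality_dep => X.
  by apply: functional_extensionality_dep => Y; apply/funext => h; apply: e.
by case: _ / e m1' mM' => m1' mM'; congr Functor; apply: Prop_irrelevance.
Qed.

Lemma fcompA (A B C D : category) (H : functor C D) (G : functor B C)
    (E : functor A B) : fcomp (fcomp H G) E = fcomp H (fcomp G E).
Proof. exact: functor_ext. Qed.

Section FunctorsAndInterleavings.
Variables (R : realType) (C D : category) (K : functor C D) (d : R).

(** The target is the shift of a composite rather than the composite of a
    shift: the two functors agree on objects and morphisms by conversion and
    differ in their proofs of functoriality only, so no transport is needed. *)
Definition whisker (M N : persistent R C) (f : nattrans M (shift d N)) :
  nattrans (fcomp K M) (shift d (fcomp K N)).
refine (@NatTrans _ _ (fcomp K M) (shift d (fcomp K N))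
  (fun t => fmap K (f t)) _).
by move=> s t h; rewrite /= -!fmapM; congr fmap; apply: (natural f).
Defined.

Lemma transl2_fcomp (d0 : 0 <= d) (M : persistent R C) (t : R) :
  transl2 d0 (fcomp K M) t = fmap K (transl2 d0 M t).
Proof. by rewrite /= fmapM. Qed.

Lemma interleaved_fcomp (d0 : 0 <= d) (M N : persistent R C)
    (f : nattrans M (shift d N)) (g : nattrans N (shift d M)) :
  (forall t, fmap K (ntcomp (shiftnt d g) f t) = fmap K (transl2 d0 M t)) ->
  (forall t, fmap K (ntcomp (shiftnt d f) g t) = fmap K (transl2 d0 N t)) ->
  interleaved d0 (fcomp K M) (fcomp K N).
Proof.
move=> gf fg; exists (whisker f), (whisker g).
split; apply: nattrans_ext => t; rewrite transl2_fcomp.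
- by rewrite -gf fmapM.
- by rewrite -fg fmapM.
Qed.

End FunctorsAndInterleavings.

Lemma dI_le (R : realType) (C : category) (M N : persistent R C) (d : R)
    (d0 : 0 <= d) : interleaved d0 M N -> (dI M N <= d%:E)%E.
Proof. by move=> MN; apply: ereal_inf_lbound; exists d => //; exists d0. Qed.

Lemma dI_fcomp (R : realType) (C D : category) (K : functor C D)
    (M N : persistent R C) : (dI (fcomp K M) (fcomp K N) <= dI M N)%E.
Proof.
apply/le_ereal_inf => _ [d [d0 [f [g [gf fg]]]] <-]; exists d => //; exists d0.
by apply: (@interleaved_fcomp _ _ _ K d d0 M N f g) => t; rewrite ?gf ?fg.
Qed.

(** * The prism identity *)

Section Prism.
Variables (W : zmodType) (T U : Type).

(** The sign is read off the parity of the index, so that the values may lie in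
    any abelian group. *)
Definition altsum (n : nat) (h : nat -> W) : W :=
  \sum_(i < n) (if odd i then - h i else h i).

Lemma altsum0 h : altsum 0 h = 0.
Proof. by rewrite /altsum big_ord0. Qed.

Lemma altsumS n h : altsum n.+1 h = h 0%N - altsum n (fun i => h i.+1).
Proof.
rewrite /altsum big_ord_recl /= -sumrN; congr (_ + _).
by apply: eq_bigr => i _; rewrite /= /bump /= add1n /=; case: odd; rewrite /= ?opprK.
Qed.

Lemma eq_altsum n h h' :
  (forall i, (i < n)%N -> h i = h' i) -> altsum n h = altsum n h'.
Proof. by move=> e; apply: eq_bigr => i _; rewrite e. Qed.

Lemma altsumB n h h' : altsum n (fun i => h i - h' i) = altsum n h - altsum n h'.
Proof.
rewrite /altsum -sumrB; apply: eq_bigr => i _.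
by case: odd; rewrite // opprB addrC opprK.
Qed.

Definition prism (f g : T -> U) (i : nat) (s : seq T) : seq U :=
  map f (take i.+1 s) ++ map g (drop i s).

Lemma prism0 f g x s : prism f g 0 (x :: s) = f x :: map g (x :: s).
Proof. by rewrite /prism /= take0. Qed.

Lemma prismS f g i x s : prism f g i.+1 (x :: s) = f x :: prism f g i s.
Proof. by []. Qed.

Lemma size_prism f g i s : (i < size s)%N -> size (prism f g i s) = (size s).+1.
Proof.
by elim: s i => // x s IH [|i] hi; rewrite ?prism0 ?prismS /= ?size_map ?IH.
Qed.

(** The chain homotopy equation, before any sequence is declared degenerate.
    The inner faces of consecutive prisms cancel in pairs, and the faces
    through one vertex of [s] are the prisms over the faces of [s].  Allowing
    any [a] is what makes an induction on [s] possible: prefixing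
    [f x] to all sequences amounts to replacing [a]. *)
Lemma prism_identity (f g : T -> U) (a : seq U -> W) (s : seq T) :
  altsum (size s) (fun i => altsum (size s).+1 (fun j => a (face j (prism f g i s))))
  + altsum (size s)
      (fun j => altsum (size s).-1 (fun i => a (prism f g i (face j s))))
  = a (map g s) - a (map f s).
Proof.
elim: s a => [|x s IH] a; first by rewrite !altsum0 addr0 subrr.
have face0 (V : Type) (y : V) r : face 0 (y :: r) = r by rewrite /face /= drop0.
(* Only the deletion of the first entry [f x] changes the shape of a prism that
   starts later; it leaves the prism over [s]. *)
have inner i : altsum (size s).+2 (fun j => a (face j (prism f g i.+1 (x :: s)))) =
    a (prism f g i s)
    - altsum (size s).+1 (fun j => a (f x :: face j (prism f g i s))).
  by rewrite altsumS prismS face0.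
have outer j : (j < size s)%N ->
    altsum (size s) (fun i => a (prism f g i (face j.+1 (x :: s)))) =
    a [:: f x, g x & map g (face j s)]
    - altsum (size s).-1 (fun i => a (f x :: prism f g i (face j s))).
  by case: (size s) => // n _; rewrite altsumS face_cons prism0.
rewrite /= (altsumS (size s)) (altsumS (size s) (fun j => altsum _ _)).
rewrite (eq_altsum (fun i _ => inner i)) (eq_altsum outer) !altsumB.
rewrite altsumS prism0 !face0 altsumS !face_cons !face0 /=.
move: (IH (fun r => a (f x :: r))).
rewrite (@eq_altsum _ (fun j => a (f x :: g x :: face j _))
  (fun j => a [:: f x, g x & map g (face j s)])); last first.
  by move=> j _; rewrite map_face.
set P := altsum _ (fun i => a (prism f g i s)).
set Q := altsum _ (fun i => a [:: f x, g x & _]).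
set D := altsum _ _; set E := altsum _ _.
move=> /(canRL (addrK _)) ->.
(* [P] collects the prisms over [s] and [Q] the sequences f x, g x, g (face j s);
   each occurs once as a face of a prism and once as a prism over a face. *)
rewrite -/(map g s); move: (a _) (a _) (a _) => A B C.
rewrite (opprB P) -addrA subrKA !opprB subrKA -(addrA B) -addrA subrKA.
by rewrite (addrC Q) subrK.
Qed.

End Prism.

(** * Degenerate prisms *)

(** Images of cliques under collapsing maps may repeat a vertex, but then some
    repetition is adjacent; only adjacent repetitions make the two
    surviving faces cancel. *)
Definition stutters (T : Type) (s : seq T) :=
  exists s1 y s2, s = s1 ++ [:: y, y & s2].

Lemma stutters_cons (T : Type) (x : T) s : stutters s -> stutters (x :: s).
Proof. by case=> s1 [y [s2 ->]]; exists (x :: s1), y, s2. Qed.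

Lemma stutters_not_uniq (T : eqType) (s : seq T) : stutters s -> uniq s = false.
Proof.
by case=> s1 [y [s2 ->]]; rewrite cat_uniq /= inE eqxx /= !andbF.
Qed.

Definition clique_or_stutters (G : digraph) (s : seq G) :=
  dclique s \/ stutters s.

Lemma dclique_cons (G : digraph) (x : G) (s : seq G) :
  dclique (x :: s) = [&& x \notin s, all (edge x) s & dclique s].
Proof. by rewrite /dclique /=; case: (_ \notin _); case: uniq; case: all. Qed.

Lemma clique_or_stutters_cons (G : digraph) (x : G) (s : seq G) :
  (forall y, y \in s -> x = y \/ edge x y) ->
  (x \in s -> exists s', s = x :: s') ->
  clique_or_stutters s -> clique_or_stutters (x :: s).
Proof.
move=> xs hd [cs|/(stutters_cons x)]; last by right.
have [/hd[s' ->]|nxs] := boolP (x \in s); first by right; exists [::], x, s'.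
left; rewrite dclique_cons nxs cs andbT; apply/allP => y ys.
by case: (xs y ys) => // xy; move: nxs; rewrite xy ys.
Qed.

Section DegeneratePrisms.
Variables (G H : digraph).

Lemma map_clique_or_stutters (f : tcmap G H) (s : seq G) :
  dclique s -> clique_or_stutters (map f s).
Proof.
move=> cs; have [us|nu] := boolP (uniq (map f s)).
  by left; rewrite map_dclique.
have [s1 [x [y [s2 [-> fxy]]]]] := map_dclique_collapse cs nu.
by right; exists (map f s1), (f x), (map f s2); rewrite map_cat /= fxy.
Qed.

(** A repetition [f x = g z] with [x -> z] forces [f x = g x] by condition (2),
    while [f x = f z] forces equality with the [f]-image of the vertex that
    follows [x], since [f] collapses triangles; in both cases the first entry
    is repeated at once. *)
Lemma prism_clique (f g : tcmap G H) (i : nat) (s : seq G) :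
  one_step f g -> dclique s -> (i < size s)%N ->
  clique_or_stutters (prism f g i s).
Proof.
case=> h1 h2; elim: s i => // x s IH i cs hi.
have := cs; rewrite dclique_cons => /and3P[_ /allP xs cs'].
case: i hi => [|i] hi.
  rewrite prism0; apply: clique_or_stutters_cons.
  - move=> _ /mapP[z zs ->]; apply: h1; move: zs; rewrite inE.
    by case/predU1P => [->|/xs]; [left|right].
  - move=> fxs; exists (map g s); congr (_ :: _); case/mapP: fxs => z.
    by rewrite inE => /predU1P[->//|/xs xz /(h2 _ _ xz)[-> ->]].
  - exact: map_clique_or_stutters.
rewrite prismS; apply: clique_or_stutters_cons; last exact: IH.
- move=> y; rewrite mem_cat => /orP[] /mapP[z zs ->].
    by apply: tc_edge; apply: xs; apply: mem_take zs.
  by apply: h1; right; apply: xs; apply: mem_drop zs.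
move=> fxs; have [z zs fxz] : exists2 z, z \in s & f x = f z.
  move: fxs; rewrite mem_cat => /orP[] /mapP[z zs fxz].
    by exists z => //; apply: mem_take zs.
  have {}zs := mem_drop zs.
  by exists z => //; case: (h2 _ _ (xs _ zs) fxz).
case: s {IH fxs} cs cs' xs hi zs => // y s cs _ xs hi zs.
suff e : f x = f y.
  by case: i hi => [|i] hi; rewrite ?prism0 ?prismS e; eexists.
move: zs; rewrite inE => /predU1P[<-//|zs].
case: (@tc_triangle _ _ f x y z) => //.
move: cs; rewrite dclique3 !dclique_cons => /and3P[_ _ /and3P[_ /allP ys _]].
by rewrite !xs ?inE ?eqxx ?zs ?orbT // ys.
Qed.

End DegeneratePrisms.

(** * Homotopic maps agree on homology *)

Section Homotopy.
Variable F : fieldType.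

Lemma altsum_sign (V : lmodType F) n (h : nat -> V) :
  altsum n h = \sum_(i < n) (-1) ^+ i *: h i.
Proof.
apply: eq_bigr => i _.
by rewrite -signr_odd; case: odd; rewrite ?expr1 ?expr0 ?scale1r ?scaleN1r.
Qed.

Lemma linear_altsum (V W : lmodType F) (u : {linear V -> W}) n (h : nat -> V) :
  u (altsum n h) = altsum n (fun i => u (h i)).
Proof.
by rewrite !altsum_sign linear_sum; apply: eq_bigr => i _; rewrite linearZ.
Qed.

Lemma basisv_not_uniq (G : digraph) k (s : seq G) :
  uniq s = false -> basisv F k s = 0.
Proof. by move=> us; rewrite /basisv insubF // /dclique us andbF. Qed.

(** The face formula survives for a stuttering sequence, where [basisv] is 0:
    the faces omitting either copy of the repeated entry are equal and have
    opposite signs, and all other faces keep the repetition. *)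
Lemma flagdiff_basisv (G : digraph) (k : nat) (s : seq G) :
  size s = k.+2 -> clique_or_stutters s ->
  flagdiff (basisv F k.+1 s) = altsum k.+2 (fun i => basisv F k (face i s)).
Proof.
move=> sz [cs|st]; rewrite altsum_sign; first exact: flagdiffE.
rewrite basisv_not_uniq ?stutters_not_uniq // linear0; apply/esym.
case: st sz => s1 [y [s2 ->]]; rewrite size_cat /= !addnS => -[sz].
have hi : ((size s1).+1 < k.+2)%N by rewrite !ltnS -sz leq_addr.
pose b i := (-1) ^+ i *: basisv F k (face i (s1 ++ [:: y, y & s2])).
apply: (big_two_cancel (g := b) hi) => [|i i1 i2]; rewrite /b.
  by rewrite face_dup exprS mulN1r scaleNr subrr.
by rewrite basisv_not_uniq ?scaler0 ?face_dup_nuniq.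
Qed.

Lemma flagmap_basisv (G H : digraph) (f : tcmap G H) k (c : clique G k) :
  flagmap f (basisv F k (val c)) = basisv F k (map f (val c)).
Proof.
have [sz cs] := cliqueP c; rewrite flagmapE //.
by case: ifP => // us; rewrite basisv_not_uniq.
Qed.

Variables (G H : digraph) (f g : tcmap G H).

Definition flagprism k : flagchain F G k -> flagchain F H k.+1 :=
  linext (fun c : clique G k =>
    altsum k.+1 (fun i => basisv F k.+1 (prism f g i (val c)))).

HB.instance Definition _ k := GRing.Linear.copy (@flagprism k) (linext _).

Lemma flagprismE k (s : seq G) : size s = k.+1 -> dclique s ->
  flagprism (basisv F k s) =
    altsum k.+1 (fun i => basisv F k.+1 (prism f g i s)).
Proof.
move=> sz cs; rewrite /basisv insubT ?sz ?eqxx // => h.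
by rewrite /flagprism linextU.
Qed.

Hypothesis fg : one_step f g.

Lemma diff_flagprism k (s : seq G) : size s = k.+1 -> dclique s ->
  flagdiff (flagprism (basisv F k s)) =
  altsum k.+1 (fun i => altsum k.+2 (fun j => basisv F k (face j (prism f g i s)))).
Proof.
move=> sz cs; rewrite flagprismE // linear_altsum.
apply: eq_altsum => i hi; apply: flagdiff_basisv; first by rewrite size_prism sz.
by apply: prism_clique; rewrite ?sz.
Qed.

(** Degree 0 is separate because the differential of [flagcx F G] has target
    degree 0 there, where [flagprism] would raise the degree too far; the
    faces of a single vertex contribute an empty sum to [prism_identity]. *)
Lemma flag_prism0 (x : flagchain F G 0) :
  flagdiff (flagprism x) = flagmap g x - flagmap f x.
Proof.
apply: (@malg_linear_eq _ _ _ (@flagdiff F H 1 \o @flagprism 0)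
  (@flagmap F _ _ g 0 \- @flagmap F _ _ f 0)) => c /=.
have [sz cs] := cliqueP c.
rewrite -basisvE diff_flagprism // !flagmap_basisv.
have := prism_identity f g (basisv F 0) (val c).
by rewrite sz [X in _ + X]altsumS !altsum0 subr0 addr0.
Qed.

(** The chain homotopy from the chain map of [f] to that of [g]: on a clique it
    is [prism_identity] applied to [basisv], since [prism_clique] makes the face
    formula valid for each prism. *)
Lemma flag_prism k (x : flagchain F G k.+1) :
  flagdiff (flagprism x) + flagprism (flagdiff x) = flagmap g x - flagmap f x.
Proof.
apply: (@malg_linear_eq _ _ _
  ((@flagdiff F H k.+2 \o @flagprism k.+1) \+ (@flagprism k \o @flagdiff F G k.+1))
  (@flagmap F _ _ g k.+1 \- @flagmap F _ _ f k.+1)) => c /=.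
have [sz cs] := cliqueP c.
rewrite -basisvE diff_flagprism // !flagmap_basisv.
rewrite flagdiff_basisv //; last by left.
rewrite linear_altsum -(prism_identity f g) sz; congr (_ + _).
by apply: eq_altsum => j hj; rewrite /= flagprismE ?face_dclique // size_face sz.
Qed.

Lemma one_step_HdFl :
  fmap (HdFl F) (f : @hom TcDgr G H) = fmap (HdFl F) (g : @hom TcDgr G H).
Proof.
apply: functional_extensionality_dep => k; apply: linear_ext => x /=.
rewrite -[x]hmlreprK !hml_mapE; apply/esym/hmlclassP/asboolP.
case: (hmlrepr x) => c /= hc; have {hc} c0 : flagdiff c = 0 by apply/eqP.
exists (flagprism c) => /=.
case: k {x} c c0 => [|k] c c0; first exact: flag_prism0.
by rewrite -flag_prism c0 linear0 addr0.
Qed.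

End Homotopy.

(** * Descent to the homotopy category *)

Lemma simeq_HdFl (F : fieldType) (G H : digraph) (f g : @hom TcDgr G H) :
  simeq f g -> fmap (HdFl F) f = fmap (HdFl F) g.
Proof.
elim=> [a b ab|a|a b _ <-|a b c _ -> _ ->] //.
exact: one_step_HdFl.
Qed.

Definition HdFl_htpy (F : fieldType) : functor hTcDgr (grVec F).
refine (@Functor hTcDgr (grVec F) (fun G => HdFl F G)
  (fun G H c => fmap (HdFl F) (repr c : @hom TcDgr G H)) _ _).
- move=> G; rewrite -(fmap1 (HdFl F)); apply: simeq_HdFl.
  by apply/hclassP; rewrite hclass_repr.
- move=> G H K g f; rewrite -(fmapM (HdFl F)); apply: simeq_HdFl.
  by apply/hclassP; rewrite hclass_repr.
Defined.

Lemma HdFl_factor (F : fieldType) : HdFl F = fcomp (HdFl_htpy F) hquot.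
Proof.
apply: functor_ext => G H f; apply: simeq_HdFl.
by apply/hclassP; rewrite hclass_repr.
Qed.

Theorem corollary6p4 (F : fieldType) (R : realType) :
  (exists K : functor hTcDgr (grVec F), HdFl F = fcomp K hquot) /\
  (forall M N : persistent R TcDgr,
     (dI (fcomp (HdFl F) M) (fcomp (HdFl F) N)
        <= dI (fcomp hquot M) (fcomp hquot N))%E /\
     (dI (fcomp hquot M) (fcomp hquot N) <= dI M N)%E) /\
  (forall (M N : persistent R TcDgr) (d : R) (d0 : 0 <= d)
      (f : nattrans M (shift d N)) (g : nattrans N (shift d M)),
     (forall t : R, simeq (ntcomp (shiftnt d g) f t) (transl2 d0 M t)) ->
     (forall t : R, simeq (ntcomp (shiftnt d f) g t) (transl2 d0 N t)) ->
     (dI (fcomp (HdFl F) M) (fcomp (HdFl F) N) <= d%:E)%E).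
Proof.
have contract M N : (dI (fcomp (HdFl F) M) (fcomp (HdFl F) N)
    <= dI (fcomp hquot M) (fcomp hquot N) :> \bar R)%E.
  by rewrite HdFl_factor !fcompA; apply: dI_fcomp.
split; first by exists (HdFl_htpy F); apply: HdFl_factor.
split=> [M N|M N d d0 f g gf fg]; first by split; [apply: contract|apply: dI_fcomp].
apply: le_trans (contract M N) _; apply: (dI_le (d0 := d0)).
apply: (interleaved_fcomp (f := f) (g := g)) => t; apply/hclassP.
- exact: gf.
- exact: fg.
Qed.
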